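(* Let $p$ be an odd prime. Define $S=S_1\cup S_2$, a set of pairs of integers, where $$S_1=\{(k,d)\mid 1\le k\le d\le p+1-k\}$$ and $$S_2=\{(k,bp+d)\mid b\ge 1,\ 1\le k\le (p+1)/2,\ k-1\le d\le p+1-k\},$$ with $k,d,b$ ranging over the integers. If $m,n$ are integers with $1\le m<p$ and $n\ge m$, then the Jordan partition $\lambda(m,n,p)$ is standard if and only if $(m,n)\in S$.
   Context: Jordan partition: let $p$ be a prime, $K$ a field of characteristic $p$, and $G$ a cyclic group of order $q=p^\alpha$. There are exactly $q$ isomorphism classes of indecomposable $KG$-modules; let $V_1,\dots,V_q$ be representatives with $\dim V_i=i$. For positive integers $m\le n$ (with $\alpha$ chosen so that $n\le q$), the $KG$-module $V_m\otimes V_n$ (tensor product over $K$ with diagonal $G$-action) decomposes as a direct sum $V_{\lambda_1}\oplus\dots\oplus V_{\lambda_m}$ of exactly $m$ indecomposable modules with $\lambda_1\ge\dots\ge\lambda_m>0$; the $\lambda_i$ depend only on $m,n,p$. The Jordan partition is $\lambda(m,n,p)=(\lambda_1,\dots,\lambda_m)$, a partition of $mn$. The partition $\lambda(m,n,p)$ (with $m\le n$) is called standard if and only if $\lambda_i=m+n-2i+1$ for all $1\le i\le m$. *)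

(* Defs.v *)
From HB Require Import structures.
From mathcomp Require Import all_boot all_order all_fingroup all_algebra.
From mathcomp Require Import all_solvable all_character.
From mathcomp Require Import boolp classical_sets.

Set Implicit Arguments.
Unset Strict Implicit.
Unset Printing Implicit Defensive.

Import Order.TTheory GRing.Theory Num.Theory.

Local Open Scope ring_scope.

Section JordanPartition.

Variables (K : fieldType) (gT : finGroupType) (G : {group gT}).

Definition mx_indecomposable (d : nat) (rG : mx_representation K G d) : Prop :=
  (0 < d)%N /\
  forall U W : 'M[K]_d, mxmodule rG U -> mxmodule rG W ->
    (U + W :=: 1%:M)%MS -> (U :&: W = 0)%MS -> U = 0 \/ W = 0.

(* [V] lists KG-modules by dimension.  For a cyclic p-group [G] and a field [K]
   of characteristic p, the indecomposable KG-modules have dimension at most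
   [#|G|] and are determined up to isomorphism by it; [V i] carries no
   meaning for [i = 0] or [#|G| < i], hence the bounds on the parts of [la]. *)
Variable V : forall i : nat, mx_representation K G i.

Definition is_jordan_partition (m n : nat) (la : seq nat) : Prop :=
  [/\ size la = m,
      sorted geq la,
      all (fun i => 0 < i <= #|G|)%N la
    & mx_rsim (prod_repr (V m) (V n))
              (\big[dadd_grepr/grepr0]_(i <- la) Representation (V i))].

(* The default [::] is standard (see below) for no [m > 0]. *)
Definition jordan_partition (m n : nat) : seq nat :=
  xget [::] (is_jordan_partition m n).

End JordanPartition.

(* Sequences are 0-based, partitions 1-based.  The truncated subtraction is
   exact for [i <= m <= n]. *)
Definition standard (m n : nat) (la : seq nat) : Prop :=
  forall i : nat, (1 <= i <= m)%N -> nth 0%N la i.-1 = (m + n - 2 * i + 1)%N.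

Definition standard_pairs1 (p : nat) : set (int * int) :=
  [set x | exists k d : int,
     [/\ 1 <= k, k <= d, d <= p%:Z + 1 - k & x = (k, d)]]%classic.

Definition standard_pairs2 (p : nat) : set (int * int) :=
  [set x | exists k b d : int,
     [/\ 1 <= b, 1 <= k <= ((p%:Z + 1) %/ 2)%Z,
         k - 1 <= d <= p%:Z + 1 - k & x = (k, b * p%:Z + d)]]%classic.

Definition standard_pairs (p : nat) : set (int * int) :=
  (standard_pairs1 p `|` standard_pairs2 p)%classic.

(* Main.v *)
(* Let g generate G.  Jordan theory, in the form of [rsim_dsum], says that a
   KG-module M is determined by its rank profile k |-> rank (g - 1)^k, which is
   i - k (truncated) on V_i, so everything is a computation of the rank profile
   R_m of V_m (x) V_n.
   - If p divides k, then g^p acts trivially on V_m, hence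
     (g - 1)^k = 1 (x) (g - 1)^k on V_m (x) V_n and R_m(k) = m (n - k).
   - If p does not divide k, then the rank of (g - 1)^k on V_2 (x) M is the sum
     of the ranks of (g - 1)^(k-1) and (g - 1)^(k+1) on M.  Comparing rank
     profiles gives V_2 (x) V_j = V_(j+1) + V_(j-1) for 0 < j < p, and tensoring
     this with V_n gives
       R_(j+1)(k) + R_(j-1)(k) = R_j(k-1) + R_j(k+1).
   These relations determine R_m.  The rank profile of the standard partition
   satisfies the recurrence at every k > 0, and by convexity it equals m (n - k)
   exactly when |n - k| >= m - 1.  So lambda(m, n, p) is standard if and only if
   no multiple k of p satisfies |n - k| <= m - 2, that is, (m, n) \in S. *)
Require Import Defs.
From HB Require Import structures.
From mathcomp Require Import all_boot all_order all_fingroup all_algebra.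
From mathcomp Require Import all_solvable all_character.
From mathcomp Require Import boolp classical_sets.
From mathcomp Require Import zify.

Set Implicit Arguments.
Unset Strict Implicit.
Unset Printing Implicit Defensive.

Import Order.TTheory GRing.Theory Num.Theory.

Local Open Scope ring_scope.

(** * Nilpotent matrices and rank profiles *)

Section RankProfile.
Variable K : fieldType.

Definition urank d (A : 'M[K]_d) k := \rank ((A - 1) ^+ k).

(** The base change is rectangular because dimensions such as (m1 + m2) * n and m1 * n + m2 * n are
    equal but not convertible. *)
Definition mxsim d1 (A1 : 'M[K]_d1) d2 (A2 : 'M[K]_d2) : Prop :=
  exists2 P : 'M_(d1, d2) * 'M_(d2, d1),
    P.1 *m P.2 = 1%:M /\ P.2 *m P.1 = 1%:M & A1 = P.1 *m A2 *m P.2.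

Lemma mxsim_sym d1 (A1 : 'M[K]_d1) d2 (A2 : 'M[K]_d2) :
  mxsim A1 A2 -> mxsim A2 A1.
Proof.
case=> [[P Q]] /= [PQ QP] ->; exists (Q, P) => //=.
by rewrite !mulmxA QP mul1mx -mulmxA QP mulmx1.
Qed.

Lemma mxsim_trans d1 (A1 : 'M[K]_d1) d2 (A2 : 'M[K]_d2) d3 (A3 : 'M[K]_d3) :
  mxsim A1 A2 -> mxsim A2 A3 -> mxsim A1 A3.
Proof.
case=> [[P Q]] /= [PQ QP] -> [[P' Q']] /= [PQ' QP'] ->.
exists (P *m P', Q' *m Q); rewrite /= ?mulmxA //; split.
  by rewrite -(mulmxA P) PQ' mulmx1.
by rewrite -(mulmxA Q') QP mulmx1.
Qed.

Lemma mxrank_sim d1 (A1 : 'M[K]_d1) d2 (A2 : 'M[K]_d2) :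
  mxsim A1 A2 -> \rank A1 = \rank A2.
Proof.
case=> [[P Q]] /= [PQ QP] ->.
rewrite mxrankMfree; last by apply/row_freeP; exists P.
by rewrite eqmxMfull //; apply/row_fullP; exists Q.
Qed.

Lemma mxsim_expB1 d1 d2 (P : 'M[K]_(d1, d2)) (A : 'M[K]_d2) Q k :
  P *m Q = 1%:M -> Q *m P = 1%:M ->
  (P *m A *m Q - 1) ^+ k = P *m (A - 1) ^+ k *m Q.
Proof.
move=> PQ QP; elim: k => [|k IHk]; first by rewrite !expr0 -!idmxE mulmx1 PQ.
rewrite !exprS IHk -!mulmxE.
have ->: P *m A *m Q - 1 = P *m (A - 1) *m Q.
  by rewrite mulmxBr mulmxBl -idmxE mulmx1 PQ.
by rewrite !mulmxA -(mulmxA _ Q P) QP mulmx1.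
Qed.

Lemma urank_sim d1 (A1 : 'M[K]_d1) d2 (A2 : 'M[K]_d2) k :
  mxsim A1 A2 -> urank A1 k = urank A2 k.
Proof.
suff le_rank d d' (A : 'M[K]_d) (A' : 'M[K]_d') :
    mxsim A A' -> (urank A k <= urank A' k)%N.
  by move=> s; apply/eqP; rewrite eqn_leq !le_rank //; apply: mxsim_sym.
case=> [[P Q]] /= [PQ QP] ->; rewrite /urank mxsim_expB1 //.
exact: leq_trans (mxrankM_maxl _ _) (mxrankM_maxr _ _).
Qed.

Lemma expmx_block_diag m n (A : 'M[K]_m) (B : 'M[K]_n) k :
  (block_mx A 0 0 B : 'M_(m + n)) ^+ k = block_mx (A ^+ k) 0 0 (B ^+ k).
Proof.
elim: k => [|k IHk]; first by rewrite !expr0 -!idmxE -scalar_mx_block.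
by rewrite !exprS IHk -!mulmxE mulmx_block !(mulmx0, mul0mx, addr0, add0r).
Qed.

Lemma urank_block_diag m n (A : 'M[K]_m) (B : 'M[K]_n) k :
  urank (block_mx A 0 0 B) k = (urank A k + urank B k)%N.
Proof.
rewrite /urank -rank_diag_block_mx -expmx_block_diag -!idmxE.
by rewrite (scalar_mx_block m n) opp_block_mx add_block_mx !oppr0 !addr0.
Qed.

(** For s <= e + 1 the powers decrease down the rows, so [N] sends each row but the first to the one
    above it. *)
Definition row_chain d (N : 'M[K]_d) (v : 'rV_d) s e : 'M_(s, d) :=
  \matrix_(i < s) (v *m N ^+ (e - i)).

Definition col_chain d (N : 'M[K]_d) (f : 'cV_d) s : 'M_(d, s) :=
  \matrix_(i < d, j < s) (N ^+ j *m f) i 0.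

(* The product has entries [v N^(e - i + j + c) f], so it is lower triangular
   with nonzero constant diagonal. *)
Lemma chain_pairing d (N : 'M[K]_d) v f s e j :
    (s <= e.+1)%N -> N ^+ (e + j).+1 = 0 -> v *m N ^+ (e + j) *m f != 0 ->
  row_chain N v s e *m N ^+ j *m col_chain N f s \in unitmx.
Proof.
move=> le_s N0 vf; set H := _ *m _.
have HE (i c : 'I_s) : H i c = (v *m N ^+ (e - i + j + c) *m f) 0 0.
  rewrite !exprD -!mulmxE -!mulmxA !mulmxA.
  transitivity ((row i (row_chain N v s e *m N ^+ j)
                 *m col c (col_chain N f s)) 0 0).
    rewrite [LHS]mxE [RHS]mxE; apply: eq_bigr => x _.
    by congr (_ * _); rewrite [RHS]mxE.
  rewrite row_mul rowK -!mulmxA; congr ((_ *m (_ *m (_ *m _))) 0 0).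
  by apply/matrixP=> x y; rewrite (ord1 y) [LHS]mxE [LHS]mxE.
rewrite unitmxE unitfE det_trig; last first.
  apply/is_trig_mxP => i c lt_ic; rewrite HE.
  have ->: (e - i + j + c = (e + j).+1 + (c - i.+1))%N.
    by have := ltn_ord i; lia.
  by rewrite exprD N0 mul0r mulmx0 mul0mx mxE.
rewrite prodf_seq_neq0; apply/allP => i _ /=; rewrite HE.
have ->: (e - i + j + i = e + j)%N by have := ltn_ord i; lia.
by apply: contraNneq vf => vf0; rewrite [X in X == _]mx11_scalar vf0 raddf0.
Qed.

Lemma mx_neq0_pairing m n (A : 'M[K]_(m, n)) :
  A != 0 -> exists v : 'rV_m, exists f : 'cV_n, v *m A *m f != 0.
Proof.
move=> A0; have [/existsP[i /existsP[j Aij]]|/existsPn A0'] :=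
  boolP [exists i, exists j, A i j != 0].
  exists (delta_mx 0 i), (delta_mx j 0); rewrite -rowE -colE.
  apply: contraNneq Aij => Aij0.
  by have := congr1 (fun M : 'M_1 => M 0 0) Aij0; rewrite !mxE => ->.
case/eqP: A0; apply/matrixP => i j; rewrite mxE.
by have /existsPn/(_ j) := A0' i; rewrite negbK => /eqP.
Qed.

(** The invertible matrix of [chain_pairing], of order e + 1 - j, factors through N^j. *)
Lemma mxrank_nilpotent_ge d (N : 'M[K]_d) e j :
  N ^+ e != 0 -> N ^+ e.+1 = 0 -> (e.+1 - j <= \rank (N ^+ j))%N.
Proof.
move=> Ne0 NeS0; case: (leqP j e) => [le_je|lt_ej]; last by lia.
have [v [f vf]] := mx_neq0_pairing Ne0.
have eE : (e - j + j = e)%N by rewrite subnK.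
have := @chain_pairing d N v f (e - j).+1 (e - j) j (leqnn _).
rewrite eE => /(_ NeS0 vf); rewrite -row_free_unit => /eqP rkH.
rewrite subSn // -{1}rkH; apply: leq_trans (mxrankM_maxl _ _) _.
exact: mxrankM_maxr.
Qed.

(* [A] is unipotent with a single Jordan block. *)
Definition unicyclic d (A : 'M[K]_d) :=
  [/\ (0 < d)%N, (A - 1) ^+ d.-1 != 0 & (A - 1) ^+ d = 0].

(** Let N = A - 1. For k <= d, the lower bounds on the ranks of N^k and N^(d - k) add up to d, and
    N^k N^(d - k) = 0 makes d an upper bound on the sum. *)
Lemma urank_unicyclic d (A : 'M[K]_d) k : unicyclic A -> urank A k = (d - k)%N.
Proof.
case=> d0 Nd1 Nd; case: (leqP k d) => [le_kd|lt_dk]; last first.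
  have ->: (k = d + (k - d))%N by lia.
  by rewrite /urank exprD Nd mul0r mxrank0; lia.
have dE : d.-1.+1 = d by lia.
have Nd' : (A - 1) ^+ d.-1.+1 = 0 by rewrite dE.
have lk := mxrank_nilpotent_ge k Nd1 Nd'.
have ldk := mxrank_nilpotent_ge (d - k) Nd1 Nd'.
have /mulmx0_rank_max : (A - 1) ^+ k *m (A - 1) ^+ (d - k) = 0.
  by rewrite mulmxE -exprD subnKC.
by rewrite /urank; rewrite dE in lk ldk; lia.
Qed.

(** In a basis formed by a Jordan chain, both matrices become the same lower triangular Jordan
    block. *)
Lemma unicyclic_sim d (A1 A2 : 'M[K]_d) : unicyclic A1 -> unicyclic A2 ->
  exists2 B, B \in unitmx & A1 *m B = B *m A2.
Proof.
have chain A : unicyclic A -> exists2 U : 'M[K]_d, U \in unitmx &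
    U *m A = (\matrix_(i, j) (j.+1 == i)%:R + 1) *m U.
  have [N ->] : exists N : 'M[K]_d, A = N + 1 by exists (A - 1); rewrite subrK.
  rewrite /unicyclic addrK => -[d0 Nd1 Nd].
  have [v [f vf]] := mx_neq0_pairing Nd1.
  have dE : d.-1.+1 = d by lia.
  have := @chain_pairing d N v f d d.-1 0 (leqSpred _).
  (* The invertible pairing is a product of two square matrices, so the row chain is itself a
     basis. *)
  rewrite addn0 dE => /(_ Nd vf); rewrite expr0 -idmxE mulmx1 unitmx_mul.
  case/andP=> Uu _; exists (row_chain N v d d.-1) => //.
  rewrite mulmxDr mulmxDl mulmx1 mul1mx.
  congr (_ + _); apply/row_matrixP => i; rewrite row_mul rowK row_mul.
  case: i => [[|i] lt_i].
    have ->: row (Ordinal lt_i) (\matrix_(i, j) (j.+1 == i)%:R) = 0 :> 'rV[K]_d.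
      by apply/rowP => j; rewrite !mxE.
    by rewrite mul0mx -mulmxA mulmxE -exprSr subn0 dE Nd mulmx0.
  have ->: row (Ordinal lt_i) (\matrix_(i, j) (j.+1 == i)%:R) =
           delta_mx 0 (Ordinal (ltnW lt_i)) :> 'rV[K]_d.
    by apply/rowP => j; rewrite !mxE eqxx.
  rewrite -rowE rowK -mulmxA mulmxE -exprSr /=.
  by congr (_ *m _ ^+ _); lia.
move=> /chain[U1 U1u U1E] /chain[U2 U2u U2E].
exists (invmx U1 *m U2); first by rewrite unitmx_mul unitmx_inv U1u.
rewrite -[RHS]mulmxA U2E !mulmxA; congr (_ *m _).
by apply: (canRL (mulKmx _)) => //; rewrite !mulmxA U1E mulmxK.
Qed.

(* [U] is spanned by a Jordan chain [v N^i] of maximal length, and [W] is the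
   common kernel of the functionals [N^i f], where [v N^e f != 0]. *)
Lemma nilpotent_split d (N : 'M[K]_d) e :
    N ^+ e != 0 -> N ^+ e.+1 = 0 ->
  exists U W : 'M_d,
    [/\ (U *m N <= U)%MS, (W *m N <= W)%MS, (U + W :=: 1%:M)%MS,
        (U :&: W = 0)%MS & \rank U = e.+1 /\ U *m N ^+ e != 0].
Proof.
move=> Ne NeS; have [v [f vf]] := mx_neq0_pairing Ne.
have := @chain_pairing d N v f e.+1 e 0 (leqnn _).
rewrite addn0 => /(_ NeS vf); rewrite expr0 -idmxE mulmx1.
set U := row_chain _ _ _ _; set F := col_chain _ _ _ => Hu.
have Ufree : \rank U = e.+1.
  apply/eqP; rewrite eqn_leq rank_leq_row /=.
  by move: Hu; rewrite -row_free_unit => /eqP {1}<-; apply: mxrankM_maxl.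
exists <<U>>%MS, (kermx F); split.
- rewrite (eqmxMr _ (genmxE U)) genmxE; apply/row_subP => i.
  rewrite row_mul rowK -mulmxA mulmxE -exprSr.
  case: i => [[|i] lt_i] /=; first by rewrite subn0 NeS mulmx0 sub0mx.
  rewrite (_ : (e - i.+1).+1 = e - i)%N; last by lia.
  by rewrite -[_ *m _](rowK (fun i : 'I_e.+1 => v *m N ^+ (e - i))
                        (Ordinal (ltnW lt_i))) row_sub.
- apply/sub_kermxP; apply/matrixP => i j; rewrite mxE.
  have colF (x : 'I_e.+1) : col x F = N ^+ x *m f.
    by apply/matrixP => y z; rewrite (ord1 z) mxE [LHS]mxE.
  have kerS (x : 'I_e.+1) : kermx F *m (N ^+ x *m f) = 0.
    by rewrite -colF colE mulmxA mulmx_ker mul0mx.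
  suff /matrixP/(_ i 0) : kermx F *m N *m col j F = 0.
    by rewrite colE mulmxA -colE !mxE.
  rewrite colF -mulmxA (mulmxA N) mulmxE -exprS.
  case: (ltnP j.+1 e.+1) => [lt_j|le_j]; first exact: (kerS (Ordinal lt_j)).
  have ->: j.+1 = e.+1 by have := ltn_ord j; lia.
  by rewrite NeS mul0mx mulmx0.
- apply/eqmxP; rewrite submx1 /=.
  (* F (U F)^-1 U is the projection onto U along the kernel of F. *)
  rewrite -[X in (X <= _)%MS](subrK (F *m invmx (U *m F) *m U)).
  rewrite addrC addmx_sub_adds //; first by rewrite genmxE submxMl.
  by apply/sub_kermxP; rewrite mulmxBl mul1mx -!mulmxA mulVmx // mulmx1 subrr.
- apply/eqP/rowV0P => u; rewrite sub_capmx genmxE => /andP[/submxP[c ->]].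
  move/sub_kermxP; rewrite -mulmxA => cH0.
  by rewrite -[c](mulmxK Hu) cH0 mul0mx mul0mx.
split; first by rewrite mxrank_gen.
apply: contraNneq vf => UN0.
have : (row ord_max U *m N ^+ e <= <<U>>%MS *m N ^+ e)%MS.
  by apply: submxMr; rewrite genmxE row_sub.
by rewrite UN0 submx0 rowK subnn expr0 -idmxE mulmx1 => /eqP->; rewrite mul0mx.
Qed.

End RankProfile.

(** * Representations of cyclic groups *)

Section CyclicRepresentations.
Variables (K : fieldType) (gT : finGroupType) (G : {group gT}) (g : gT).
Hypothesis defG : G :=: <[g]>%g.
Local Notation reprG := (mx_representation K G).

Let Gg : g \in G. Proof. by rewrite defG cycle_id. Qed.

Lemma mx_rsim_mxsim d1 (rG1 : reprG d1) d2 (rG2 : reprG d2) :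
  mx_rsim rG1 rG2 -> mxsim (rG1 g) (rG2 g).
Proof.
case=> B def_d1; rewrite def_d1 in rG1 B *; rewrite row_free_unit => uB homB.
by exists (B, invmx B); rewrite /= ?mulVmx ?mulmxV // -homB // mulmxK.
Qed.

Lemma repr_mx_expg d (rG : reprG d) k : rG (g ^+ k)%g = rG g ^+ k.
Proof.
elim: k => [|k IHk]; first by rewrite expg0 expr0 repr_mx1 idmxE.
by rewrite expgS exprS repr_mxM ?groupX // IHk mulmxE.
Qed.

Lemma mxmodule_cycle d (rG : reprG d) (U : 'M_d) :
  (U *m (rG g - 1) <= U)%MS -> mxmodule rG U.
Proof.
move=> UN; suff stab_g : (<[g]> \subset rstabs rG U)%g.
  by rewrite -defG in stab_g.
rewrite cycle_subG inE Gg /=.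
by rewrite -[rG g](subrK 1) mulmxDr -idmxE mulmx1 addmx_sub.
Qed.

Lemma unicyclic_rsim d1 (rG1 : reprG d1) d2 (rG2 : reprG d2) : d1 = d2 ->
  unicyclic (rG1 g) -> unicyclic (rG2 g) -> mx_rsim rG1 rG2.
Proof.
move=> def_d1; rewrite def_d1 in rG1 *.
move=> uc1 uc2; have [B uB homB] := unicyclic_sim uc1 uc2.
exists B; rewrite ?row_free_unit // => x.
rewrite {1}defG => /cycleP[i ->]; elim: i => [|i IHi].
  by rewrite expg0 !repr_mx1 mul1mx mulmx1.
by rewrite expgS !repr_mxM ?groupX // -mulmxA IHi !mulmxA homB.
Qed.

Lemma submod_repr_expB1 d (rG : reprG d) (U : 'M_d) (modU : mxmodule rG U) k :
  val_submod ((submod_repr modU g - 1) ^+ k) =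
  val_submod 1%:M *m (rG g - 1) ^+ k.
Proof.
elim: k => [|k IHk]; first by rewrite !expr0 -!idmxE mulmx1.
rewrite !exprSr -!mulmxE mulmxA -IHk mulmxBr linearB /=.
by rewrite val_submodJ // mulmxBr -!idmxE !mulmx1.
Qed.

(** Since g generates G, the summands of [nilpotent_split] are submodules. On U, of dimension e + 1,
    the power (g - 1)^e is nonzero, so U is a single Jordan block. *)
Lemma mx_split d (rG : reprG d) e :
    (rG g - 1) ^+ e != 0 -> (rG g - 1) ^+ e.+1 = 0 ->
  exists U W : 'M_d, exists modU : mxmodule rG U,
    [/\ mxmodule rG W, (U + W :=: 1%:M)%MS, (U :&: W = 0)%MS,
        \rank U = e.+1 & unicyclic (submod_repr modU g)].
Proof.
move=> Ne NeS; have [U [W [UN WN sUW dUW [rU UNe]]]] := nilpotent_split Ne NeS.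
have modU := mxmodule_cycle UN.
exists U, W, modU; split=> //; first exact: mxmodule_cycle.
split; first by rewrite rU.
  rewrite -val_submod_eq0 submod_repr_expB1 [X in X.-1]rU.
  apply: contraNneq UNe => vN0.
  have : (U *m (rG g - 1) ^+ e <=
          val_submod (1%:M : 'M_(\rank U)) *m (rG g - 1) ^+ e)%MS.
    by rewrite submxMr // val_submod1.
  by rewrite vN0 => /submx0null->.
apply/eqP; rewrite -val_submod_eq0 submod_repr_expB1.
by rewrite [X in _ ^+ X]rU NeS mulmx0.
Qed.

(** Let k + 1 be the nilpotency index of g - 1. The summand of dimension k + 1 given by [mx_split]
    is nonzero, so it is the whole module. *)
Lemma mx_indecomposable_unicyclic d (rG : reprG d) e : (rG g - 1) ^+ e = 0 ->
  mx_indecomposable rG -> unicyclic (rG g).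
Proof.
move=> Ne0 [d0 indec].
have exN : exists k, (rG g - 1) ^+ k == 0 by exists e; apply/eqP.
case: (ex_minnP exN) => -[|k] /eqP Nk0 kmin.
  move: Nk0; rewrite expr0 -idmxE => /matrixP/(_ (Ordinal d0) (Ordinal d0))/eqP.
  by rewrite !mxE eqxx oner_eq0.
have Nk : (rG g - 1) ^+ k != 0.
  by apply/negP => /kmin; rewrite ltnn.
have [U [W [modU [modW sUW dUW rU ucU]]]] := mx_split Nk Nk0.
have [U0|W0] := indec U W modU modW sUW dUW.
  by move: rU; rewrite U0 mxrank0.
have dE : d = k.+1.
  by rewrite -rU -[LHS](mxrank1 K) -sUW W0 addsmx0.
by split; rewrite // ?[X in X.-1]dE // [X in _ ^+ X]dE.
Qed.

Variables (q : nat) (V : forall i : nat, reprG i).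
Hypothesis ucV : forall i, (1 <= i <= q)%N -> unicyclic (V i g).

Local Notation dsumV la :=
  (\big[dadd_grepr/grepr0]_(i <- la) Representation (V i)).

Lemma urank_dsum la k : all (fun i => 0 < i <= q)%N la ->
  urank (dsumV la g) k = (\sum_(i <- la) (i - k))%N.
Proof.
elim: la => [|a la IHla] /= => [_|/andP[a0 /IHla{}IHla]].
  by rewrite !big_nil /urank; apply/eqP; rewrite -leqn0 rank_leq_row.
by rewrite !big_cons urank_block_diag IHla urank_unicyclic //; apply: ucV.
Qed.

(** Induction on [la]: the largest part is the nilpotency index of g - 1, hence [mx_split] splits
    off a block of that size. *)
Lemma rsim_dsum la d (rG : reprG d) :
    sorted geq la -> all (fun i => 0 < i <= q)%N la ->
    (forall k, urank (rG g) k = \sum_(i <- la) (i - k))%N ->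
  mx_rsim rG (dsumV la).
Proof.
elim: la d rG => [|a la IHla] d rG.
  move=> _ _ /(_ 0%N); rewrite !big_nil /urank expr0 -idmxE mxrank1 => d0.
  rewrite d0 in rG *; exists 0 => [//||x Gx]; last by rewrite mulmx0 mul0mx.
  by rewrite /row_free mxrank0.
rewrite big_cons => la_sorted /= /andP[a0q la0q] rk.
have a0 : (0 < a)%N by case/andP: a0q.
have la_sorted' := path_sorted la_sorted.
have le_la i : i \in la -> (i <= a)%N.
  have geq_trans : transitive geq by move=> x y z /= h1 h2; exact: leq_trans h1.
  by move/(allP (order_path_min geq_trans la_sorted)).
have aE : a.-1.+1 = a by lia.
have Na0 : (rG g - 1) ^+ a.-1.+1 = 0.
  apply/eqP; rewrite aE -mxrank_eq0 [\rank _]rk big_cons subnn big_seq.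
  by rewrite big1 // => i /le_la; lia.
have Na : (rG g - 1) ^+ a.-1 != 0.
  rewrite -mxrank_eq0 [\rank _]rk big_cons; lia.
have [U [W [modU [modW sUW dUW rU ucU]]]] := mx_split Na Na0.
have dxUW : mxdirect (U + W) by apply/mxdirect_addsP.
have rsimU : mx_rsim (submod_repr modU) (V a).
  by apply: unicyclic_rsim; [rewrite rU | | apply: ucV].
have split_rG (rW : representation K G) : mx_rsim (submod_repr modW) rW ->
    mx_rsim rG (dadd_grepr (Representation (V a)) rW).
  have /mx_rsim_sym rG1 := rsim_submod1 (mxmodule1 rG) (eqmx_refl _).
  move=> rsimW; apply: mx_rsim_trans rG1 _.
  exact: (@mx_rsim_dadd _ _ _ _ _ U W 1%:M (Representation (V a)) rW modU modW).
apply: (split_rG); apply: IHla => // k.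
(* Cancelling the profile of [V a] from that of [rG] leaves the profile of the complement W. *)
have rW := split_rG (Representation (submod_repr modW)) (mx_rsim_refl _).
have := urank_sim k (mx_rsim_mxsim rW).
rewrite rk big_cons urank_block_diag urank_unicyclic; last exact: ucV.
by move/addnI.
Qed.

End CyclicRepresentations.

(** * Tensor products *)

Section TensorProduct.
Variable K : fieldType.

Lemma tprodDl m1 n1 (A A' : 'M[K]_(m1, n1)) m2 n2 (B : 'M[K]_(m2, n2)) :
  tprod (A + A') B = tprod A B + tprod A' B.
Proof.
elim: m1 A A' => [|m1 IHm] A A' /=; first by rewrite addr0.
by rewrite linearD [dsubmx _]linearD /= IHm -!trowbE linearD add_col_mx.
Qed.

Lemma tprodBr m1 n1 (A : 'M[K]_(m1, n1)) m2 n2 (B B' : 'M[K]_(m2, n2)) :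
  tprod A (B - B') = tprod A B - tprod A B'.
Proof.
elim: m1 A => [|m1 IHm] A /=; first by rewrite subr0.
by rewrite IHm linearB /= opp_col_mx add_col_mx.
Qed.

Lemma tprod0l m1 n1 m2 n2 (B : 'M[K]_(m2, n2)) :
  tprod (0 : 'M_(m1, n1)) B = 0.
Proof. by apply: (@addrI _ (tprod 0 B)); rewrite -tprodDl !addr0. Qed.

Lemma tprod_sim d1 (A1 : 'M[K]_d1) d2 (A2 : 'M[K]_d2) n (B : 'M[K]_n) :
  mxsim A1 A2 -> mxsim (tprod A1 B) (tprod A2 B).
Proof.
case=> [[P Q]] /= [PQ QP] ->; exists (tprod P 1%:M, tprod Q 1%:M) => /=.
  by rewrite -!tprodE PQ QP mulmx1 !tprod1.
by rewrite -!tprodE mulmx1 mul1mx.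
Qed.

(** The base change consists of the coordinate projections and injections tensored with the
    identity, so the mixed product rule [tprodE] does the computation. *)
Lemma tprod_block_sim m1 m2 (Aul : 'M[K]_m1) Aur Adl (Adr : 'M[K]_m2)
    n (B : 'M[K]_n) :
  mxsim (tprod (block_mx Aul Aur Adl Adr) B)
    (block_mx (tprod Aul B) (tprod Aur B) (tprod Adl B) (tprod Adr B)).
Proof.
pose I1 : 'M[K]_(m1, m1 + m2) := row_mx 1%:M 0.
pose I2 : 'M[K]_(m2, m1 + m2) := row_mx 0 1%:M.
pose J1 : 'M[K]_(m1 + m2, m1) := col_mx 1%:M 0.
pose J2 : 'M[K]_(m1 + m2, m2) := col_mx 0 1%:M.
have IJ11 : I1 *m J1 = 1%:M by rewrite mul_row_col mulmx1 mul0mx addr0.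
have IJ12 : I1 *m J2 = 0 by rewrite mul_row_col mulmx0 mul0mx addr0.
have IJ21 : I2 *m J1 = 0 by rewrite mul_row_col mulmx0 mul0mx addr0.
have IJ22 : I2 *m J2 = 1%:M by rewrite mul_row_col mulmx1 mul0mx add0r.
have JI : J1 *m I1 + J2 *m I2 = 1%:M.
  rewrite !mul_col_row !mul0mx !mulmx0 !mulmx1 add_block_mx !addr0 !add0r.
  by rewrite -scalar_mx_block.
exists (row_mx (tprod J1 1%:M) (tprod J2 1%:M),
        col_mx (tprod I1 1%:M) (tprod I2 1%:M)) => /=.
  split.
    by rewrite mul_row_col -!tprodE -tprodDl JI mulmx1 tprod1.
  rewrite mul_col_row -!tprodE IJ11 IJ12 IJ21 IJ22 !tprod0l mulmx1 !tprod1.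
  by rewrite -scalar_mx_block.
rewrite mul_row_block -!tprodE !mul1mx mul_row_col -!tprodDl -!tprodE !mulmx1.
rewrite -tprodDl; set A' := (_ *m I1 + _ in RHS).
have -> : A' = block_mx Aul Aur Adl Adr => [|//].
rewrite /A' !mul_col_mx !mul1mx !mul0mx !add_col_mx !addr0 !add0r.
by rewrite !mul_col_row !mulmx1 !mulmx0 add_block_mx !addr0 !add0r.
Qed.

Lemma tprod_1x1_sim n (B : 'M[K]_n) : mxsim (tprod (1%:M : 'M_1) B) B.
Proof.
(* The dimension 1 * n unfolds to n + 0 * n, which leaves an empty block. *)
exists ((col_mx 1%:M 0 : 'M[K]_(n + 0 * n, n)),
        (row_mx 1%:M 0 : 'M[K]_(n, n + 0 * n))) => /=.
  split; last by rewrite mul_row_col mulmx1 mul0mx addr0.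
  rewrite mul_col_row mulmx1 !mulmx0 mul0mx [RHS]scalar_mx_block.
  by congr block_mx; apply/matrixP; case.
rewrite !mxE /= mul_col_mx mul1mx mul0mx mul_col_mx mul0mx; congr col_mx.
rewrite mul_mx_row mulmx1 mulmx0 [X in row_mx _ X]thinmx0; congr row_mx.
by rewrite scale1r.
Qed.

Lemma mxrank_tprod1 m n (B : 'M[K]_n) :
  \rank (tprod (1%:M : 'M_m) B) = (m * \rank B)%N.
Proof.
elim: m => [|m IHm]; first by rewrite flatmx0 mxrank0.
have := mxrank_sim (@tprod_block_sim 1 m 1%:M 0 0 1%:M n B).
rewrite -scalar_mx_block => ->; rewrite !tprod0l rank_diag_block_mx.
by rewrite IHm (mxrank_sim (tprod_1x1_sim _)).
Qed.

Lemma tprod_exp m n (A : 'M[K]_m) (B : 'M[K]_n) k :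
  tprod A B ^+ k = tprod (A ^+ k) (B ^+ k).
Proof.
elim: k => [|k IHk]; first by rewrite !expr0 -!idmxE tprod1.
by rewrite !exprS IHk -!mulmxE tprodE.
Qed.

Variables (p : nat) (charK : p \in [pchar K]).

Lemma expmxB1_pchar d (A : 'M[K]_d) a :
  (A - 1) ^+ (p ^ a) = A ^+ (p ^ a) - 1.
Proof.
case: d A => [|d] A; first by rewrite [LHS]flatmx0 [RHS]flatmx0.
have charM : p \in [pchar 'M[K]_d.+1].
  rewrite inE (pcharf_prime charK) /= -idmxE.
  rewrite -[_ *+ _](raddfMn (@scalar_mx K d.+1)).
  by rewrite (pcharf0 charK) raddf0.
elim: a => [|a IHa]; first by rewrite !expr1.
rewrite expnSr !exprM IHa -!(pFrobenius_autE charM) pFrobenius_autB_comm.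
  by rewrite pFrobenius_aut1.
exact: commr1.
Qed.

(** By Frobenius A^p = 1, so the p-th power of A (x) B - 1 is A^p (x) B^p - 1 = 1 (x) (B - 1)^p. *)
Lemma urank_tprod_mulp m n (A : 'M[K]_m) (B : 'M[K]_n) k :
  (A - 1) ^+ p = 0 -> (p %| k)%N -> urank (tprod A B) k = (m * urank B k)%N.
Proof.
move=> Ap /dvdnP[j ->]; rewrite (mulnC j) /urank exprM.
have := expmxB1_pchar (tprod A B) 1; rewrite expn1 => ->.
have := expmxB1_pchar A 1; rewrite expn1 Ap => /esym/eqP.
rewrite subr_eq0 => /eqP A1.
have -> : 1 = tprod (1 : 'M[K]_m) (1 : 'M[K]_n) by rewrite -!idmxE tprod1.
rewrite tprod_exp A1 -tprodBr tprod_exp.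
have := expmxB1_pchar B 1; rewrite expn1 => <-.
by rewrite -exprM expr1n mxrank_tprod1.
Qed.

(** A polynomial f of the shear has C f'(C) in its corner; here f = (x - 1)^(k + 1), and the factor
    k + 1 is where divisibility by p matters. *)
Lemma expmx_block_shear d (C : 'M[K]_d) k :
  (block_mx C C 0 C - 1 : 'M_(d + d)) ^+ k.+1 =
  block_mx ((C - 1) ^+ k.+1) (C *m (C - 1) ^+ k *+ k.+1) 0 ((C - 1) ^+ k.+1).
Proof.
have ->: block_mx C C 0 C - 1 = block_mx (C - 1) C 0 (C - 1) :> 'M_(d + d).
  by rewrite -!idmxE (scalar_mx_block d d) opp_block_mx add_block_mx !subr0.
elim: k => [|k IHk]; first by rewrite !expr1 expr0 -idmxE mulmx1.
rewrite exprS IHk -mulmxE mulmx_block !(mulmx0, mul0mx, addr0, add0r).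
congr block_mx; rewrite ?mulmxE -?exprS // mulrnAr mulrA [in RHS]mulrS.
rewrite addrC (_ : (C - 1) * C = C * (C - 1)) -?mulrA -?exprS //.
by rewrite mulrBl mulrBr mul1r mulr1.
Qed.

(** Elimination with the corner [D] as pivot: [L] and [R] reduce the matrix to diag(D, - X X D). *)
Lemma mxrank_block_shear d (X D : 'M[K]_d) : X *m D = D *m X ->
  \rank (block_mx (X *m D) D 0 (X *m D)) = (\rank D + \rank (X *m X *m D))%N.
Proof.
move=> XD; pose L : 'M[K]_(d + d) := block_mx 1%:M 0 (- X) 1%:M.
pose R : 'M[K]_(d + d) := block_mx 0 1%:M 1%:M (- X).
have Lu : row_full L.
  apply/row_fullP; exists (block_mx 1%:M 0 X 1%:M).
  rewrite mulmx_block !(mulmx0, mul0mx, addr0, add0r, mulmx1, mul1mx) subrr.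
  by rewrite -scalar_mx_block.
have Ru : row_free R.
  apply/row_freeP; exists (block_mx X 1%:M 1%:M 0).
  rewrite mulmx_block !(mulmx0, mul0mx, addr0, add0r, mulmx1, mul1mx) subrr.
  by rewrite -scalar_mx_block.
rewrite -(mxrankMfree _ Ru) -(eqmxMfull _ Lu) /L /R.
rewrite !mulmx_block !(mulmx0, mul0mx, addr0, add0r, mulmx1, mul1mx).
rewrite !mulmxN XD subrr mulmx0 !mulNmx XD addNr sub0r rank_diag_block_mx.
by rewrite mxrank_opp -(mulmxA X X D) XD mulmxA XD.
Qed.

Lemma block_shear_sim d1 (B1 : 'M[K]_d1) d2 (B2 : 'M[K]_d2) :
  mxsim B1 B2 -> mxsim (block_mx B1 B1 0 B1) (block_mx B2 B2 0 B2).
Proof.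
case=> [[P Q]] /= [PQ QP] ->; exists (block_mx P 0 0 P, block_mx Q 0 0 Q) => /=.
  rewrite !mulmx_block !(mulmx0, mul0mx, addr0, add0r) PQ QP.
  by rewrite -!scalar_mx_block.
by rewrite !mulmx_block !(mulmx0, mul0mx, addr0, add0r).
Qed.

Lemma tprod2_sim (A : 'M[K]_2) n (B : 'M[K]_n) :
  unicyclic A -> mxsim (tprod A B) (block_mx B B 0 B).
Proof.
move=> ucA; pose A' : 'M[K]_(1 + 1) := block_mx 1%:M 1%:M 0 1%:M.
have A'E : A' - 1 = block_mx 0 1%:M 0 0.
  rewrite -idmxE (scalar_mx_block 1 1) opp_block_mx add_block_mx.
  by rewrite !subr0 !subrr.
have ucA' : unicyclic A'.
  split=> //; rewrite /= A'E.
    apply/negP => /eqP/matrixP/(_ (lshift 1 0) (rshift 1 0))/eqP.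
    by rewrite block_mxEur !mxE eqxx oner_eq0.
  by rewrite expr2 -mulmxE mulmx_block !(mulmx0, mul0mx, addr0) block_mx0.
have AA' : mxsim A A'.
  have [P uP homP] := unicyclic_sim ucA ucA'.
  by exists (P, invmx P); rewrite /= ?mulVmx ?mulmxV // -homP mulmxK.
apply: mxsim_trans (tprod_sim B AA') _.
apply: mxsim_trans (tprod_block_sim _ _ _ _ _) _.
by rewrite tprod0l; apply: block_shear_sim (tprod_1x1_sim B).
Qed.

(** Both sides are similar to the block shear of C (x) B. *)
Lemma tprod2A_sim (A : 'M[K]_2) m (C : 'M[K]_m) n (B : 'M[K]_n) :
  unicyclic A -> mxsim (tprod (tprod A C) B) (tprod A (tprod C B)).
Proof.
move=> ucA; apply: mxsim_trans (tprod_sim B (tprod2_sim C ucA)) _.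
apply: mxsim_trans (tprod_block_sim _ _ _ _ _) _.
by rewrite tprod0l; apply: mxsim_sym; apply: tprod2_sim.
Qed.

Lemma urank_tprod2 (A : 'M[K]_2) n (C : 'M[K]_n) k :
    unicyclic A -> C \in unitmx -> ~~ (p %| k.+1)%N ->
  urank (tprod A C) k.+1 = (urank C k + urank C k.+2)%N.
Proof.
move=> ucA uC pk; rewrite (urank_sim _ (tprod2_sim C ucA)).
rewrite /urank expmx_block_shear; set Y := C - 1; set c := k.+1%:R : K.
have c0 : c != 0 by rewrite -(dvdn_pcharf charK).
have CY : C * Y = Y * C by rewrite mulrBl mulrBr mul1r mulr1.
have CYj j : C * Y ^+ j = Y ^+ j * C by apply: commrX.
have VC : invmx C * C = 1 by rewrite -mulmxE mulVmx.
have CV : C * invmx C = 1 by rewrite -mulmxE mulmxV.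
(* Chosen so that [D] is the corner and X D = Y^(k + 1) the diagonal block. As c and C are
   invertible, D and X X D have the ranks of Y^k and Y^(k + 2). *)
pose D : 'M[K]_n := c *: (C * Y ^+ k); pose X := c^-1 *: (invmx C * Y).
have XD : X * D = Y ^+ k.+1.
  rewrite /X /D -mulmxE -scalemxAl -scalemxAr scalerA mulVf // scale1r !mulmxE.
  by rewrite -mulrA (mulrA Y) -CY -mulrA -exprS mulrA VC mul1r.
have DX : D * X = Y ^+ k.+1.
  rewrite /X /D -mulmxE -scalemxAl -scalemxAr scalerA mulfV // scale1r.
  by rewrite !mulmxE CYj -mulrA (mulrA C) CV mul1r -exprSr.
have -> : C *m Y ^+ k *+ k.+1 = D by rewrite /D scaler_nat mulmxE.
rewrite -XD -mulmxE mxrank_block_shear; last by rewrite !mulmxE DX.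
have fullC j : \rank (C *m Y ^+ j) = \rank (Y ^+ j).
  by rewrite eqmxMfull // row_full_unit.
congr (_ + _)%N; first by rewrite mxrank_scale_nz // -mulmxE fullC.
rewrite -mulmxA (XD : X *m D = _) /X -scalemxAl mxrank_scale_nz ?invr_eq0 //.
rewrite mulmxE -mulrA -exprS -mulmxE eqmxMfull //.
by rewrite row_full_unit unitmx_inv.
Qed.

End TensorProduct.

(** * The standard partition *)

Definition std_part (m n : nat) : seq nat :=
  mkseq (fun i => m + n - 2 * i.+1 + 1)%N m.

Lemma std_partE m n k : (\sum_(a <- std_part m n) (a - k) =
  \sum_(i < m) (m + n - 2 * i.+1 + 1 - k))%N.
Proof.
rewrite big_map -(big_mkord xpredT (fun i => m + n - 2 * i.+1 + 1 - k)%N).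
by rewrite /index_iota subn0.
Qed.

(** All parts of [std_part m.+2 n] but the last are the parts of [std_part m.+1 n] plus one. The
    last, n - m - 1, and the parts of [std_part m n] are the parts of [std_part m.+1 n] minus
    one. *)
Lemma sum_std_part_rec m n k : (m < n)%N ->
  (\sum_(a <- std_part m.+2 n) (a - k.+1) +
     \sum_(a <- std_part m n) (a - k.+1) =
   \sum_(a <- std_part m.+1 n) (a - k) +
     \sum_(a <- std_part m.+1 n) (a - k.+2))%N.
Proof.
move=> lt_mn; rewrite !std_partE big_ord_recr.
rewrite [X in (_ = _ + X)%N]big_ord_recr /= -!addnA; congr (_ + _)%N.
  by apply: eq_bigr => i _; have := ltn_ord i; lia.
rewrite addnC; congr (_ + _)%N; last by lia.
by apply: eq_bigr => i _; have := ltn_ord i; lia.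
Qed.

(* Truncated subtraction is convex, so the average of [a - K] over the standard
   parts [a], which are symmetric about [n], is at least [n - K], with equality
   if and only if they all lie on the same side of [K]. *)
Lemma sum_std_part_eq m n K : (0 < m <= n)%N ->
  (\sum_(a <- std_part m n) (a - K) = m * (n - K))%N <->
  (K + m <= n + 1 \/ n + m <= K + 1)%N.
Proof.
case/andP=> m0 le_mn; rewrite std_partE.
(* [f i] pairs a part with its mirror image; the two add up to 2 n. *)
set f := fun i => (m + n - 2 * i.+1 + 1 - K + (n - m + 2 * i + 1 - K))%N.
have sum2 : (2 * \sum_(i < m) (m + n - 2 * i.+1 + 1 - K) = \sum_(i < m) f i)%N.
  rewrite mul2n -addnn big_split /=; congr (_ + _)%N.
  rewrite (reindex_inj rev_ord_inj) /=; apply: eq_bigr => i _.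
  by have := ltn_ord i; lia.
have const : (\sum_(i < m) 2 * (n - K) = 2 * (m * (n - K)))%N.
  by rewrite sum_nat_const card_ord; lia.
split=> [sumE|far]; last first.
  apply/eqP; rewrite -(eqn_pmul2l (isT : 0 < 2)%N) sum2 -const; apply/eqP.
  by apply: eq_bigr => i _; rewrite /f; have := ltn_ord i; lia.
have [//|near] : (K + m <= n + 1 \/ n + m <= K + 1)%N \/
    ~~ (K + m <= n + 1)%N && ~~ (n + m <= K + 1)%N by lia.
move: near sum2 const.
case: m m0 le_mn sumE @f => // m _ le_mn sumE f near sum2 const.
suff : (\sum_(i < m.+1) 2 * (n - K) < \sum_(i < m.+1) f i)%N by lia.
(* The pair at index 0 consists of the extreme parts, which lie strictly on opposite sides of K;
   this makes the inequality strict. *)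
rewrite big_ord_recl [X in (_ < X)%N]big_ord_recl -addSn leq_add //.
  by rewrite /f /=; lia.
by apply: leq_sum => i _; rewrite /f; have := ltn_ord i; lia.
Qed.

(** The largest part is the least k at which the sum vanishes, so the heads agree; they are
    cancelled and the tails compared. *)
Lemma sorted_geq_sum_inj (la mu : seq nat) :
    sorted geq la -> sorted geq mu -> all (leq 1) la -> all (leq 1) mu ->
    (forall k, \sum_(a <- la) (a - k) = \sum_(a <- mu) (a - k))%N ->
  la = mu.
Proof.
have geq_trans : transitive geq by move=> x y z /= h1 h2; exact: leq_trans h1.
have le_head a b (s t : seq nat) : sorted geq (a :: s) ->
    (\sum_(i <- a :: s) (i - a) = \sum_(i <- b :: t) (i - a))%N -> (b <= a)%N.
  move/(order_path_min geq_trans)/allP => le_a.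
  rewrite !big_cons subnn big_seq big1 => [|i /le_a]; lia.
elim: la mu => [|a la IHla] [|b mu] //=.
- by move=> _ _ _ /andP[b0 _] /(_ 0%N); rewrite big_nil big_cons; lia.
- by move=> _ _ /andP[a0 _] _ /(_ 0%N); rewrite big_nil big_cons; lia.
move=> sla smu /andP[_ la0] /andP[_ mu0] sumE.
have ab : a = b.
  apply/eqP; rewrite eqn_leq (le_head _ _ _ _ sla (sumE a)) andbT.
  exact: le_head smu (esym (sumE b)).
rewrite ab (IHla mu) ?(path_sorted sla) ?(path_sorted smu) // => k.
by have := sumE k; rewrite !big_cons ab => /addnI.
Qed.

Lemma in_standard_pairs p m n : odd p -> (0 < m)%N -> (m < p)%N -> (m <= n)%N ->
  (m%:Z, n%:Z) \in standard_pairs p <->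
  (forall K, (p %| K)%N -> K + m <= n + 1 \/ n + m <= K + 1)%N.
Proof.
move=> p_odd m0 lt_mp le_mn; rewrite in_setE; split.
  case=> [[k [d [k1 kd dp [mk nd]]]] K /dvdnP[[|c] ->]|].
  - by left; lia.
  - by right; move: dp; rewrite -mk -nd; nia.
  case=> k [b [d [b1 /andP[k1 kp] /andP[kd dp] [mk nd]]]] K /dvdnP[c ->].
  have [le_cb|lt_bc] : (c%:Z <= b) \/ (b + 1 <= c%:Z) by lia.
    by left; move: kd; rewrite -mk; nia.
  by right; move: dp; rewrite -mk; nia.
move=> far.
have rp := ltn_pmod n (leq_ltn_trans (leq0n m) lt_mp).
have nE := divn_eq n p.
(* Only the consecutive multiples b p <= n < (b + 1) p are needed. *)
have lo := far _ (dvdn_mull (n %/ p) (dvdnn p)).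
have hi := far _ (dvdn_mull (n %/ p).+1 (dvdnn p)).
have [b0|b0] := posnP (n %/ p).
  left; exists m%:Z, n%:Z; split=> //; lia.
set b := (n %/ p)%N in nE lo hi b0; set r := (n %% p)%N in nE rp.
right; exists m%:Z, b%:Z, r%:Z; split; [lia| |nia|].
  (* Adding m - 1 <= r and r <= p + 1 - m gives 2 m <= p + 2, hence 2 m <= p + 1 since p is odd. *)
  by apply/andP; split; [lia|nia].
by rewrite {1}nE.
Qed.

(** * Jordan partitions *)

Section JordanPartitionOfTensor.
Variables (p : nat) (K : fieldType) (charK : p \in [pchar K]).
Variables (gT : finGroupType) (G : {group gT}) (g : gT) (defG : G :=: <[g]>%g).
Variables (q : nat) (V : forall i : nat, mx_representation K G i).
Hypothesis ucV : forall i, (1 <= i <= q)%N -> unicyclic (V i g).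

Local Notation R n j := (urank (tprod (V j g) (V n g))).

Let repr_g_unit d (rG : mx_representation K G d) : rG g \in unitmx.
Proof. by rewrite repr_mx_unit // defG cycle_id. Qed.

Lemma repr_sub1_expp j : (0 < j <= q)%N -> (j <= p)%N -> (V j g - 1) ^+ p = 0.
Proof.
move=> /ucV[_ _ Nj0] le_jp.
by rewrite -(subnKC le_jp) exprD Nj0 mul0r.
Qed.

Lemma urank_prod_mulp n j k : (0 < j <= q)%N -> (j <= p)%N -> (0 < n <= q)%N ->
  (p %| k)%N -> R n j k = (j * (n - k))%N.
Proof.
move=> jq le_jp nq pk.
rewrite (urank_tprod_mulp charK) ?repr_sub1_expp // urank_unicyclic //.
exact: ucV.
Qed.

Lemma prod_V2_sim j : (0 < j)%N -> (j.+2 <= q)%N -> (j.+2 <= p)%N ->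
  mxsim (tprod (V 2 g) (V j.+1 g))
    (block_mx (V j.+2 g) 0 0 (block_mx (V j g) 0 0 (1 : 'M_0))).
Proof.
move=> j0 jq jp.
have := rsim_dsum (la := [:: j.+2; j]) defG ucV
  (rG := prod_repr (V 2) (V j.+1)).
rewrite !big_cons big_nil => rsimVV; apply: (mx_rsim_mxsim defG (rsimVV _ _ _)).
- by rewrite /=; lia.
- by rewrite /=; apply/and3P; split=> //; lia.
move=> k; rewrite !big_cons big_nil /=.
have uc2 : unicyclic (V 2 g) by apply: ucV; lia.
have ucj : unicyclic (V j.+1 g) by apply: ucV; lia.
(* A multiple k of p is 0, where both sides are the dimension, or at least p >= j + 2, where both
   vanish. *)
have [pk|npk] := boolP (p %| k)%N.
  rewrite urank_prod_mulp //; try lia.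
  have [->|k0] := posnP k; first by lia.
  by have := dvdn_leq k0 pk; lia.
case: k npk => [|k npk]; first by rewrite dvdn0.
by rewrite (urank_tprod2 charK) // !urank_unicyclic //; lia.
Qed.

(** Both sides are the rank of (g - 1)^(k + 1) on V_2 (x) V_(j + 1) (x) V_n, bracketed in the two
    possible ways. *)
Lemma urank_prod_rec n j k : (0 < j)%N -> (j.+2 <= q)%N -> (j.+2 <= p)%N ->
    ~~ (p %| k.+1)%N ->
  (R n j.+2 k.+1 + R n j k.+1 = R n j.+1 k + R n j.+1 k.+2)%N.
Proof.
move=> j0 jq jp npk.
have uc2 : unicyclic (V 2 g) by apply: ucV; lia.
have uP : tprod (V j.+1 g) (V n g) \in unitmx.
  exact: (repr_g_unit (prod_repr (V j.+1) (V n))).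
rewrite -(urank_tprod2 charK uc2 uP npk) -(urank_sim _ (tprod2A_sim _ _ uc2)).
rewrite (urank_sim _ (tprod_sim _ (prod_V2_sim j0 jq jp))).
rewrite (urank_sim _ (tprod_block_sim _ _ _ _ _)) !tprod0l urank_block_diag.
rewrite (urank_sim _ (tprod_block_sim _ _ _ _ _)) !tprod0l urank_block_diag.
congr (_ + _)%N; rewrite -[LHS]addn0; congr (_ + _)%N; apply/esym/eqP.
by rewrite -leqn0 rank_leq_row.
Qed.

Lemma urank_prod_std n m : (0 < m < p)%N -> (m <= n <= q)%N ->
    (forall k, p %| k -> k + m <= n + 1 \/ n + m <= k + 1)%N ->
  forall j, (0 < j <= m)%N -> forall k,
  R n j k = (\sum_(a <- std_part j n) (a - k))%N.
Proof.
move=> /andP[m0 mp] /andP[mn nq] far.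
have ucn : unicyclic (V n g) by apply: ucV; lia.
(* The recurrence has order two in j, so the induction carries two consecutive values. *)
suff std2 j : (j < m)%N ->
    (forall k, R n j.+1 k = \sum_(a <- std_part j.+1 n) (a - k))%N /\
    ((j.+1 < m)%N ->
     forall k, R n j.+2 k = (\sum_(a <- std_part j.+2 n) (a - k))%N).
  by case=> // j jm k; have [std1 _] := std2 j jm; apply: std1.
have mulp i k : (0 < i <= m)%N -> (p %| k)%N ->
    R n i k = (\sum_(a <- std_part i n) (a - k))%N.
  move=> im pk; rewrite urank_prod_mulp //; try lia.
  by apply/esym/sum_std_part_eq; [lia | have := far k pk; lia].
elim: j => [_|j IHj jm].
  split=> [k|m1 k].
    have -> : V 1 g = 1%:M.
      have [_ _] : unicyclic (V 1 g) by apply: ucV; lia.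
      by rewrite expr1 => /eqP; rewrite subr_eq0 => /eqP.
    rewrite (urank_sim _ (tprod_1x1_sim _)) urank_unicyclic // std_partE.
    by rewrite big_ord1 /=; lia.
  have [/mulp->|] := boolP (p %| k)%N; [by []| lia |].
  case: k => [|k npk]; first by rewrite dvdn0.
  rewrite (urank_tprod2 charK) //; last by apply: ucV; lia.
  by rewrite !urank_unicyclic // std_partE !big_ord_recr big_ord0 /=; lia.
have [IH1 /(_ jm) IH2] := IHj (ltnW jm); split=> // jm1 k.
have [/mulp->|] := boolP (p %| k)%N; [by []| lia |].
case: k => [|k npk]; first by rewrite dvdn0.
have := @urank_prod_rec n j.+1 k; rewrite IH1 !IH2 => rec.
have := @sum_std_part_rec j.+1 n k; have := rec; lia.
Qed.

Variables (m n : nat) (m_gt0 : (0 < m)%N) (m_lt_p : (m < p)%N).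
Variables (le_mn : (m <= n)%N) (le_nq : (n <= q)%N) (oG : #|G| = q).
(** The guard covers the trivial group, where q = 1. *)
Hypothesis p_dvd_q : (1 < q)%N -> (p %| q)%N.

Lemma jordan_partition_urank la k : is_jordan_partition V m n la ->
  R n m k = (\sum_(a <- la) (a - k))%N.
Proof.
case=> _ _ la_q /(mx_rsim_mxsim defG)/(urank_sim k) ->.
by rewrite oG in la_q; rewrite (urank_dsum ucV).
Qed.

Lemma standard_eq_std_part la :
  size la = m -> standard m n la -> la = std_part m n.
Proof.
move=> sz std; apply: (@eq_from_nth _ 0%N) => [|i]; first by rewrite size_mkseq.
rewrite sz => lt_im; rewrite nth_mkseq //.
by rewrite -(std i.+1).
Qed.

(** [jordan_partition] is a choice among all candidates; they share one rank profile, hence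
    coincide. *)
Lemma jordan_partition_standard : is_jordan_partition V m n (std_part m n) ->
  standard m n (jordan_partition V m n).
Proof.
move=> jstd; rewrite /jordan_partition (xget_unique _ jstd) => [i im|la jla].
  by rewrite nth_mkseq; [rewrite prednK//|]; lia.
have [_ s1 p1 _] := jla; have [_ s2 p2 _] := jstd.
apply: sorted_geq_sum_inj => // [||k].
- by apply: sub_all p1 => a /andP[].
- by apply: sub_all p2 => a /andP[].
by rewrite -!jordan_partition_urank.
Qed.

Lemma standard_jordan_partitionP : standard m n (jordan_partition V m n) <->
  (forall k, p %| k -> k + m <= n + 1 \/ n + m <= k + 1)%N.
Proof.
split=> [|far].
  rewrite /jordan_partition.
  (* The default [[::]] has m-th entry 0, whereas a standard partition has n - m + 1 there. *)
  case: xgetP => [la -> jla std k pk|_ std]; last first.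
    by have := std m; rewrite nth_nil; lia.
  have [sz _ _ _] := jla.
  apply/(@sum_std_part_eq m n k); first by lia.
  rewrite -(standard_eq_std_part sz std) -jordan_partition_urank //.
  by rewrite urank_prod_mulp //; lia.
(* The largest part m + n - 1 must not exceed q; this is the criterion at the multiple k = q of p,
   as n <= q. *)
have le_q : (n + m <= q + 1)%N.
  have [q_le1|/p_dvd_q/far] : (q <= 1)%N \/ (1 < q)%N by lia.
    by lia.
  by lia.
have std_q : all (fun i => 0 < i <= q)%N (std_part m n).
  by apply/allP => a /mapP[i]; rewrite mem_iota => /andP[_ im] ->; lia.
have std_sorted : sorted geq (std_part m n).
  apply/(sortedP 0%N) => i; rewrite size_mkseq => lt_im.
  by rewrite !nth_mkseq //= ?(ltnW lt_im) //; lia.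
apply: jordan_partition_standard; split=> //.
- by rewrite size_mkseq.
- by rewrite oG.
by apply: (rsim_dsum defG ucV) => // k; apply: (@urank_prod_std n m) => //; lia.
Qed.

End JordanPartitionOfTensor.

Theorem theorem1 (p : nat) (p_pr : prime p) (p_odd : odd p)
  (K : fieldType) (charK : p \in [pchar K])
  (gT : finGroupType) (G : {group gT}) (alpha : nat)
  (cycG : cyclic G) (oG : #|G| = (p ^ alpha)%N)
  (V : forall i : nat, mx_representation K G i)
  (indecV : forall i : nat, (1 <= i <= p ^ alpha)%N -> mx_indecomposable (V i))
  (m n : nat) (m_gt0 : (1 <= m)%N) (m_lt_p : (m < p)%N) (le_mn : (m <= n)%N)
  (le_nq : (n <= p ^ alpha)%N) :
  standard m n (jordan_partition V m n)
    <-> (m%:Z, n%:Z) \in standard_pairs p.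
Proof.
have [g defG] := cyclicP cycG.
have ucV i : (1 <= i <= p ^ alpha)%N -> unicyclic (V i g).
  move=> /indecV; apply: (mx_indecomposable_unicyclic defG (e := p ^ alpha)).
  (* By Frobenius, (g - 1)^(p^alpha) = g^#|G| - 1 = 0. *)
  rewrite (expmxB1_pchar charK) -(repr_mx_expg defG) -oG.
  have -> : #|G| = #[g]%g by rewrite /order -defG.
  by rewrite expg_order repr_mx1 idmxE subrr.
rewrite (in_standard_pairs p_odd) //.
apply: (standard_jordan_partitionP charK defG ucV) => //.
by case: (alpha) => [|a] //; rewrite expnS dvdn_mulr.
Qed.
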